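(* Let $K$ be a commutative ring with unit and let $(V_1,G_1)$, $(V_2,G_2)$ be representations over $K$. Then $(V_1,G_1)$ and $(V_2,G_2)$ are action type geometrically equivalent if and only if $$\mathcal{L}\mathcal{Q}^0\mathcal{Q}^r\mathcal{S}\mathcal{C}(V_1,G_1)=\mathcal{L}\mathcal{Q}^0\mathcal{Q}^r\mathcal{S}\mathcal{C}(V_2,G_2).$$
   Context: A representation $(V,G)$ over $K$ is a group $G$ together with a right $KG$-module $V$ (action written $v\circ g$). A homomorphism of representations $(\alpha,\beta):(V,G)\to(W,H)$ is a $K$-module homomorphism $\alpha:V\to W$ together with a group homomorphism $\beta:G\to H$ such that $(v\circ g)^\alpha=v^\alpha\circ g^\beta$. A subrepresentation $(V_0,G_0)\le(V,G)$ consists of a subgroup $G_0\le G$ and a $K$-submodule $V_0\le V$ that is a $KG_0$-submodule. $(V,G)$ is finitely generated if $G$ is a finitely generated group and $V$ is a finitely generated $KG$-module. For finite sets $X,Y$ let $F(Y)$ be the free group on $Y$, $XKF(Y)=\bigoplus_{x\in X}xKF(Y)$ the free right $KF(Y)$-module with basis $X$, and $W(X,Y)=(XKF(Y),F(Y))$. For $T\subset XKF(Y)$ put $T^{\nabla}_{(V,G)}=\{(\alpha,\beta)\in\mathrm{Hom}(W(X,Y),(V,G))\mid \ker\alpha\supset T\}$ and $T^{\nabla\nabla}_{(V,G)}=\bigcap_{(\alpha,\beta)\in T^{\nabla}_{(V,G)}}\ker\alpha$. Representations $(V_1,G_1)$ and $(V_2,G_2)$ are action type geometrically equivalent if $T^{\nabla\nabla}_{(V_1,G_1)}=T^{\nabla\nabla}_{(V_2,G_2)}$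 for all finite $X,Y$ and every $T\subset XKF(Y)$. Operators on a class $\mathfrak X$ of representations over $K$ (classes and operators are understood up to isomorphism): $\mathcal{C}\mathfrak X$ = all Cartesian products $(\prod_{i\in I}V_i,\prod_{i\in I}G_i)$, with componentwise action, of families of members of $\mathfrak X$; $\mathcal{S}\mathfrak X$ = all subrepresentations of members of $\mathfrak X$; $(V,G)\in\mathcal{Q}^r\mathfrak X$ iff there are $(V,D)\in\mathfrak X$ and a group epimorphism $\varphi:D\to G$ such that $(\mathrm{id}_V,\varphi):(V,D)\to(V,G)$ is a homomorphism of representations; $(V,G)\in\mathcal{Q}^0\mathfrak X$ iff there are $(V,D)\in\mathfrak X$ and a group epimorphism $\varphi:G\to D$ such that $(\mathrm{id}_V,\varphi):(V,G)\to(V,D)$ is a homomorphism of representations; $(V,G)\in\mathcal{L}\mathfrak X$ iff every finitely generated subrepresentation of $(V,G)$ belongs to $\mathfrak X$. Products of operators are compositions, applied from right to left, and an operator applied to $(V,G)$ means applied to the class $\{(V,G)\}$. *)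

(* Defs.v *)
From HB Require Import structures.
From mathcomp Require Import all_boot all_algebra.
From mathcomp Require Import boolp classical_sets functions cardinality.

Set Implicit Arguments.
Unset Strict Implicit.
Unset Printing Implicit Defensive.

Import GRing.Theory.

Local Open Scope classical_set_scope.
Local Open Scope ring_scope.

(* A right KG-module structure on the K-module V: a right action of the       *)
(* (possibly infinite) group G on V by K-linear maps.                         *)
Record action (K : comPzRingType) (V : lmodType K) (G : groupType) := Action {
  act_fun :> V -> G -> V;
  act_linear : forall g, linear (act_fun^~ g);
  act1 : forall v, act_fun v 1%g = v;
  actM : forall v g h, act_fun v (g * h)%g = act_fun (act_fun v g) h
}.

Record rep (K : comPzRingType) := Rep {
  rmod : lmodType K;
  rgrp : groupType;
  ract : action rmod rgrp
}.
Arguments ract {K r}.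

Notation "v '\o_' g" := (ract v g) (at level 40, left associativity).

Record rep_hom (K : comPzRingType) (A B : rep K) := RepHom {
  hom_mod : {linear rmod A -> rmod B};
  hom_grp : {multiplicative rgrp A -> rgrp B};
  hom_act : forall v g, hom_mod (v \o_ g) = hom_mod v \o_ hom_grp g
}.

Definition rep_iso (K : comPzRingType) (A B : rep K) : Prop :=
  exists f : rep_hom A B, bijective (hom_mod f) /\ bijective (hom_grp f).

Section Subrepresentations.
Variable K : comPzRingType.

Definition act_closed (A : rep K) (V0 : {pred rmod A}) (G0 : {pred rgrp A}) :=
  {in V0 & G0, forall v g, v \o_ g \in V0}.

Record subrep (A : rep K) := SubRep {
  sub_mod : {pred rmod A};
  sub_grp : {pred rgrp A};
  sub_modP : submod_closed sub_mod;
  sub_grpP : group_closed sub_grp;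
  sub_actP : act_closed sub_mod sub_grp
}.

Section SubrepAsRep.
Variables (A : rep K) (S : subrep A).

Definition subrep_mod := {v : rmod A | v \in sub_mod S}.
HB.instance Definition _ := SubChoice.copy subrep_mod {v : rmod A | v \in sub_mod S}.
HB.instance Definition _ :=
  GRing.SubChoice_isSubLmodule.Build K (rmod A) _ subrep_mod
    (GRing.submod_closed_semi (sub_modP S)).

Definition subrep_grp := {g : rgrp A | g \in sub_grp S}.
HB.instance Definition _ := SubChoice.copy subrep_grp {g : rgrp A | g \in sub_grp S}.
HB.instance Definition _ :=
  SubChoice_isSubGroup.Build (rgrp A) _ subrep_grp (sub_grpP S).

Definition subrep_act_fun (v : subrep_mod) (g : subrep_grp) : subrep_mod :=
  exist _ (sval v \o_ sval g) (sub_actP (svalP v) (svalP g)).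

Fact subrep_act_linear g : linear (subrep_act_fun^~ g).
Proof. by move=> a u v; apply: val_inj; apply: act_linear. Qed.

Fact subrep_act1 v : subrep_act_fun v 1%g = v.
Proof. by apply: val_inj; apply: act1. Qed.

Fact subrep_actM v g h :
  subrep_act_fun v (g * h)%g = subrep_act_fun (subrep_act_fun v g) h.
Proof. by apply: val_inj; apply: actM. Qed.

Definition rep_of_subrep : rep K :=
  Rep (Action subrep_act_linear subrep_act1 subrep_actM).

End SubrepAsRep.
End Subrepresentations.

Definition fg_group (G : groupType) : Prop :=
  exists s : seq G, forall P : {pred G},
    group_closed P -> {subset s <= P} -> forall g, g \in P.

Definition fg_module (K : comPzRingType) (A : rep K) : Prop :=
  exists s : seq (rmod A), forall P : {pred rmod A},
    submod_closed P -> act_closed P predT ->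
    {subset s <= P} -> forall v, v \in P.

Definition fg_rep (K : comPzRingType) (A : rep K) : Prop :=
  fg_group (rgrp A) /\ fg_module A.

Section CartesianProduct.
Variables (K : comPzRingType) (I : Type) (F : I -> rep K).

Definition prod_mod := forall i, rmod (F i).
HB.instance Definition _ := gen_eqMixin prod_mod.
HB.instance Definition _ := gen_choiceMixin prod_mod.

Definition prod_add (u v : prod_mod) : prod_mod := fun i => u i + v i.
Definition prod_opp (u : prod_mod) : prod_mod := fun i => - u i.
Definition prod_scale (a : K) (u : prod_mod) : prod_mod := fun i => a *: u i.

Fact prod_addA : associative prod_add.
Proof. by move=> u v w; apply: functional_extensionality_dep => i; apply: addrA. Qed.
Fact prod_addC : commutative prod_add.
Proof. by move=> u v; apply: functional_extensionality_dep => i; apply: addrC. Qed.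
Fact prod_add0 : left_id (fun=> 0) prod_add.
Proof. by move=> u; apply: functional_extensionality_dep => i; apply: add0r. Qed.
Fact prod_addN : left_inverse (fun=> 0) prod_opp prod_add.
Proof. by move=> u; apply: functional_extensionality_dep => i; apply: addNr. Qed.
HB.instance Definition _ :=
  GRing.isZmodule.Build prod_mod prod_addA prod_addC prod_add0 prod_addN.

Fact prod_scaleA a b u : prod_scale a (prod_scale b u) = prod_scale (a * b) u.
Proof. by apply: functional_extensionality_dep => i; apply: scalerA. Qed.
Fact prod_scale1 : left_id 1 prod_scale.
Proof. by move=> u; apply: functional_extensionality_dep => i; apply: scale1r. Qed.
Fact prod_scaleDr : right_distributive prod_scale +%R.
Proof. by move=> a u v; apply: functional_extensionality_dep => i; apply: scalerDr. Qed.
Fact prod_scaleDl u : {morph prod_scale^~ u : a b / a + b}.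
Proof. by move=> a b; apply: functional_extensionality_dep => i; apply: scalerDl. Qed.
HB.instance Definition _ := GRing.Zmodule_isLmodule.Build K prod_mod
  prod_scaleA prod_scale1 prod_scaleDr prod_scaleDl.

Definition prod_grp := forall i, rgrp (F i).
HB.instance Definition _ := gen_eqMixin prod_grp.
HB.instance Definition _ := gen_choiceMixin prod_grp.

Definition prod_mul (g h : prod_grp) : prod_grp := fun i => (g i * h i)%g.
Definition prod_inv (g : prod_grp) : prod_grp := fun i => (g i)^-1%g.

Fact prod_mulA : associative prod_mul.
Proof. by move=> g h k; apply: functional_extensionality_dep => i; apply: mulgA. Qed.
Fact prod_mul1g : left_id (fun=> 1%g) prod_mul.
Proof. by move=> g; apply: functional_extensionality_dep => i; apply: mul1g. Qed.
Fact prod_mulg1 : right_id (fun=> 1%g) prod_mul.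
Proof. by move=> g; apply: functional_extensionality_dep => i; apply: mulg1. Qed.
Fact prod_mulVg : left_inverse (fun=> 1%g) prod_inv prod_mul.
Proof. by move=> g; apply: functional_extensionality_dep => i; apply: mulVg. Qed.
Fact prod_mulgV : right_inverse (fun=> 1%g) prod_inv prod_mul.
Proof. by move=> g; apply: functional_extensionality_dep => i; apply: mulgV. Qed.
HB.instance Definition _ := isGroup.Build prod_grp
  prod_mulA prod_mul1g prod_mulg1 prod_mulVg prod_mulgV.

Definition prod_act_fun (v : prod_mod) (g : prod_grp) : prod_mod :=
  fun i => v i \o_ g i.

Fact prod_act_linear g : linear (prod_act_fun^~ g).
Proof. by move=> a u v; apply: functional_extensionality_dep => i; apply: act_linear. Qed.
Fact prod_act1 v : prod_act_fun v 1%g = v.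
Proof. by apply: functional_extensionality_dep => i; apply: act1. Qed.
Fact prod_actM v g h :
  prod_act_fun v (g * h)%g = prod_act_fun (prod_act_fun v g) h.
Proof. by apply: functional_extensionality_dep => i; apply: actM. Qed.

Definition rep_prod : rep K :=
  Rep (Action prod_act_linear prod_act1 prod_actM).

End CartesianProduct.

(* The free group on Y: reduced words in the letters (y, false) = y and       *)
(* (y, true) = y^-1, multiplied by concatenation followed by reduction.       *)
Section FreeGroup.
Variable Y : choiceType.

Definition linv (a : Y * bool) : Y * bool := (a.1, ~~ a.2).

Definition reduced (w : seq (Y * bool)) : bool :=
  sorted (fun a b => b != linv a) w.

Definition fcons (a : Y * bool) (w : seq (Y * bool)) : seq (Y * bool) :=
  if w is b :: w' then if b == linv a then w' else a :: w else [:: a].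

Definition fmulw (u v : seq (Y * bool)) : seq (Y * bool) := foldr fcons v u.
Definition finvw (u : seq (Y * bool)) : seq (Y * bool) := rev (map linv u).

Lemma linvK : involutive linv.
Proof. by case=> y b; rewrite /linv /= negbK. Qed.

Lemma linv_neq a : a != linv a.
Proof. by case: a => y []; rewrite /linv xpair_eqE eqxx. Qed.

Lemma fcons_reduced a w : reduced w -> reduced (fcons a w).
Proof.
case: w => [//|b w] /= rw; case: ifPn => [_|nb]; first exact: path_sorted rw.
by rewrite /= nb.
Qed.

Lemma fmulw_reduced u v : reduced v -> reduced (fmulw u v).
Proof. by move=> rv; elim: u => //= a u; apply: fcons_reduced. Qed.

Lemma finvw_reduced u : reduced u -> reduced (finvw u).
Proof.
rewrite /reduced /finvw rev_sorted sorted_map; apply: sub_sorted => a b.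
by apply: contraNneq => /= ->; rewrite !linvK.
Qed.

Lemma fconsK a w : reduced w -> fcons (linv a) (fcons a w) = w.
Proof.
case: w => [_|b w] /=; first by rewrite linvK eqxx.
case: ifPn => [/eqP-> {b}|_ _] /=; last by rewrite linvK eqxx.
by case: w => [//|c w] /= /andP[/negPf->].
Qed.

Lemma fmulw_fcons a u v : reduced u -> reduced v ->
  fmulw (fcons a u) v = fcons a (fmulw u v).
Proof.
case: u => [//|b u] /= ru rv; case: ifPn => [/eqP->|//].
by rewrite -{1}[a]linvK fconsK // fmulw_reduced.
Qed.

Lemma fmulwA u v w : reduced v -> reduced w ->
  fmulw u (fmulw v w) = fmulw (fmulw u v) w.
Proof.
move=> rv rw; elim: u => //= a u ->.
by rewrite fmulw_fcons ?fmulw_reduced.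
Qed.

Lemma fmulw0 u : reduced u -> fmulw u [::] = u.
Proof.
elim: u => //= a u IHu ru; rewrite IHu; last exact: path_sorted ru.
by case: u ru {IHu} => //= b u /andP[/negPf->].
Qed.

Lemma fmulVw u : fmulw (finvw u) u = [::].
Proof.
rewrite /finvw; elim: u => //= a u IHu.
by rewrite rev_cons -cats1 /fmulw foldr_cat /= linvK eqxx.
Qed.

Lemma finvwK : involutive finvw.
Proof. by move=> u; rewrite /finvw map_rev revK mapK //; apply: linvK. Qed.

Definition free_group := {w : seq (Y * bool) | reduced w}.
HB.instance Definition _ := SubChoice.copy free_group {w : seq (Y * bool) | reduced w}.

Definition free_one : free_group := exist _ [::] isT.
Definition free_mul (u v : free_group) : free_group :=
  exist _ (fmulw (sval u) (sval v)) (fmulw_reduced _ (svalP v)).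
Definition free_inv (u : free_group) : free_group :=
  exist _ (finvw (sval u)) (finvw_reduced (svalP u)).

Fact free_mulA : associative free_mul.
Proof.
by move=> u v w; apply: val_inj; apply: fmulwA; [apply: svalP v|apply: svalP w].
Qed.
Fact free_mul1 : left_id free_one free_mul.
Proof. by move=> u; apply: val_inj. Qed.
Fact free_mulr1 : right_id free_one free_mul.
Proof. by move=> u; apply: val_inj; apply: fmulw0; apply: svalP u. Qed.
Fact free_mulV : left_inverse free_one free_inv free_mul.
Proof. by move=> u; apply: val_inj; apply: fmulVw. Qed.
Fact free_mulrV : right_inverse free_one free_inv free_mul.
Proof.
by move=> u; apply: val_inj; rewrite /= -{1}[sval u]finvwK; apply: fmulVw.
Qed.
HB.instance Definition _ := isGroup.Build free_group
  free_mulA free_mul1 free_mulr1 free_mulV free_mulrV.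

End FreeGroup.

(* KG as a right module over itself: finitely supported functions a : G -> K, *)
(* standing for the formal sums of the a(h) h, with the right translation     *)
(* (sum of a(h) h) g = sum of a(h) (h g).                                     *)
Section GroupAlgebra.
Variables (K : comPzRingType) (G : groupType).

Definition fin_supp : {pred G -> K^o} :=
  [pred a : G -> K^o | `[< finite_set [set h | a h != 0] >]].

Fact fin_supp_submod : submod_closed fin_supp.
Proof.
split=> [|c u v].
  apply/asboolP; rewrite (_ : [set _ | _] = set0) ?eqxx //.
  by apply/seteqP; split=> h //=; rewrite eqxx.
move=> /asboolP fu /asboolP fv; apply/asboolP.
apply: (@sub_finite_set _ _ ([set h | u h != 0] `|` [set h | v h != 0])); last first.
  by rewrite finite_setU.
move=> h /=; case: (eqVneq (u h) 0) => [u0|]; last by left.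
case: (eqVneq (v h) 0) => [v0|]; last by right.
by rewrite -[(c *: u + v) h]/(c * u h + v h) u0 v0 mulr0 addr0 eqxx.
Qed.

Definition grp_alg := {a : G -> K^o | a \in fin_supp}.
HB.instance Definition _ := SubChoice.copy grp_alg {a : G -> K^o | a \in fin_supp}.
HB.instance Definition _ :=
  GRing.SubChoice_isSubLmodule.Build K (G -> K^o) _ grp_alg
    (GRing.submod_closed_semi fin_supp_submod).

Definition translate (a : G -> K^o) (g : G) : G -> K^o :=
  fun h => a (h * g^-1)%g.

Fact translate_fin_supp (a : grp_alg) g : translate (sval a) g \in fin_supp.
Proof.
have /asboolP fa := svalP a; apply/asboolP.
apply: sub_finite_set (finite_image (fun h => h * g)%g fa) => h ah.
by exists (h * g^-1)%g => //=; rewrite mulgVK.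
Qed.

Definition alg_trans (a : grp_alg) (g : G) : grp_alg :=
  exist _ (translate (sval a) g) (translate_fin_supp a g).

Fact alg_trans_linear g : linear (alg_trans^~ g).
Proof. by move=> c u v; apply: val_inj. Qed.
Fact alg_trans1 a : alg_trans a 1%g = a.
Proof.
by apply: val_inj; apply/funext => h /=; rewrite /translate invg1 mulg1.
Qed.
Fact alg_transM a g h : alg_trans a (g * h)%g = alg_trans (alg_trans a g) h.
Proof.
by apply: val_inj; apply/funext => k /=; rewrite /translate invgM mulgA.
Qed.

End GroupAlgebra.

(* W(X, Y) = (XKF(Y), F(Y)), where XKF(Y) is the direct sum of copies of KF(Y) *)
(* indexed by the finite set X.                                                *)
Section FreeRep.
Variables (K : comPzRingType) (X Y : finType).

Definition free_mod : lmodType K := {ffun X -> grp_alg K (free_group Y)}.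

Definition free_act_fun (u : free_mod) (g : free_group Y) : free_mod :=
  [ffun x => alg_trans (u x) g].

Fact free_act_linear g : linear (free_act_fun^~ g).
Proof. by move=> c u v; apply/ffunP => x; rewrite !ffunE alg_trans_linear. Qed.
Fact free_act1 u : free_act_fun u 1%g = u.
Proof. by apply/ffunP => x; rewrite ffunE alg_trans1. Qed.
Fact free_actM u g h :
  free_act_fun u (g * h)%g = free_act_fun (free_act_fun u g) h.
Proof. by apply/ffunP => x; rewrite !ffunE alg_transM. Qed.

Definition free_rep : rep K :=
  Rep (Action free_act_linear free_act1 free_actM).

End FreeRep.

Section GeometricEquivalence.
Variable K : comPzRingType.

Definition hom_ker (A B : rep K) (f : rep_hom A B) : set (rmod A) :=
  [set v | hom_mod f v = 0].

Definition nabla (A : rep K) (X Y : finType) (T : set (free_mod K X Y)) :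
  set (rep_hom (free_rep K X Y) A) := [set f : rep_hom (free_rep K X Y) A | T `<=` hom_ker f].
#[global] Arguments nabla A {X Y} T.

Definition nabla2 (A : rep K) (X Y : finType) (T : set (free_mod K X Y)) :
  set (free_mod K X Y) := \bigcap_(f in nabla A T) hom_ker f.
#[global] Arguments nabla2 A {X Y} T.

Definition action_geom_equiv (A B : rep K) : Prop :=
  forall (X Y : finType) (T : set (free_mod K X Y)), nabla2 A T = nabla2 B T.

End GeometricEquivalence.

(* Classes of representations and operators on them, up to isomorphism:       *)
(* op_single, op_C and op_S yield classes closed under isomorphism, and       *)
(* op_Qr, op_Q0 and op_L preserve this closure.                               *)
Section Operators.
Variable K : comPzRingType.

Definition rep_class := rep K -> Prop.
Implicit Type X : rep_class.

Definition op_single (A : rep K) : rep_class := fun W => rep_iso W A.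

Definition op_C X : rep_class := fun W =>
  exists (I : Type) (F : I -> rep K), (forall i, X (F i)) /\ rep_iso W (rep_prod F).

Definition op_S X : rep_class := fun W =>
  exists (A : rep K) (S : subrep A), X A /\ rep_iso W (rep_of_subrep S).

Definition op_Qr X : rep_class := fun W =>
  exists (D : groupType) (a : action (rmod W) D) (f : rep_hom (Rep a) W),
    [/\ X (Rep a), hom_mod f =1 id & forall g, exists d, hom_grp f d = g].

Definition op_Q0 X : rep_class := fun W =>
  exists (D : groupType) (a : action (rmod W) D) (f : rep_hom W (Rep a)),
    [/\ X (Rep a), hom_mod f =1 id & forall d, exists g, hom_grp f g = d].

Definition op_L X : rep_class := fun W =>
  forall S : subrep W, fg_rep (rep_of_subrep S) -> X (rep_of_subrep S).

Definition same_class X X' : Prop := forall W, X W <-> X' W.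

End Operators.

(* Main.v *)
(* For a homomorphism (alpha, beta) from a free representation W(X, Y), call ker alpha
   R-closed if (ker alpha)^nabla nabla computed in R is ker alpha.  All such kernels are
   R-closed for every member of Q^0 Q^r S C R: this holds for R itself and passes to
   products and subrepresentations; for Q^r one lifts beta along the group epimorphism,
   F(Y) being free.  Conversely, if some epimorphism from W(X, Y) onto (V, G) has an
   R-closed kernel, then V is the image of XKF(Y) in the product of copies of R over all
   homomorphisms in (ker alpha)^nabla, and both G and the image of F(Y) in that product
   act on V through the same group of operators, so (V, G) is in Q^0 Q^r S C R.  Hence
   membership of a finitely generated representation depends only on the nabla nabla
   operator of R.  For the converse implication, the image of W(X, Y) in the product of
   copies of R_1 over T^nabla is finitely generated with kernel T^nabla nabla. *)
Require Import Defs.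
From HB Require Import structures.
From mathcomp Require Import all_boot all_algebra.
From mathcomp Require Import boolp classical_sets functions cardinality fsbigop.

Set Implicit Arguments.
Unset Strict Implicit.
Unset Printing Implicit Defensive.

Import GRing.Theory.

Local Open Scope classical_set_scope.
Local Open Scope ring_scope.

(* [{multiplicative _ -> _}] is the type of magma morphisms, so the library does not
   provide preservation of 1 and of inverses for it. *)
Section MultiplicativeGroup.
Variables (G H : groupType) (f : {multiplicative G -> H}).

Lemma mult1 : f 1%g = 1%g.
Proof. by apply: (mulgI (f 1%g)); rewrite -gmulfM !mulg1. Qed.

Lemma multV g : f g^-1%g = (f g)^-1%g.
Proof. by apply: (mulgI (f g)); rewrite -gmulfM !mulgV mult1. Qed.

Lemma preim_group_closed (P : {pred H}) :
  group_closed P -> group_closed [pred g | f g \in P].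
Proof.
case=> P1 PD; split=> [|g h]; first by rewrite inE mult1.
by rewrite !inE gmulfM multV => Pg Ph; apply: PD.
Qed.

Lemma image_group_closed :
  group_closed [pred h : H | `[< exists g, f g = h >]].
Proof.
split=> [|_ _ /asboolP[g <-] /asboolP[h <-]]; apply/asboolP.
  by exists 1%g; apply: mult1.
by exists (g / h)%g; rewrite gmulfM multV.
Qed.

End MultiplicativeGroup.

(** * Free groups: induction on generators and the universal property *)

Section FreeGroupTheory.
Variable Y : choiceType.

Definition free_gen (y : Y) : free_group Y := exist _ [:: (y, false)] isT.

Lemma free_group_ind (P : {pred free_group Y}) :
  group_closed P -> (forall y, free_gen y \in P) -> forall g, g \in P.
Proof.
move=> grpP genP [w rw]; elim: w rw => [|[y b] w IHw] rw.
  suff <-: 1%g = exist _ [::] rw :> free_group Y by case: grpP.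
  exact: val_inj.
have rw' : reduced w by apply: path_sorted rw.
pose l : free_group Y := exist _ [:: (y, b)] isT.
have lP : l \in P.
  rewrite /l; case: b {rw l}; last exact: genP.
  suff <-: (free_gen y)^-1%g = exist _ [:: (y, true)] isT by apply: group_closedV.
  exact: val_inj.
(* The word is reduced, so its first letter does not cancel and the product is plain
   concatenation. *)
suff <-: (l * (exist _ w rw' : free_group Y))%g = exist _ ((y, b) :: w) rw.
  by apply: (group_closedM grpP) => //; apply: IHw.
by apply: val_inj => /=; case: w rw {IHw rw'} => //= c w /andP[/negPf->].
Qed.

Variables (G : groupType) (t : Y -> G).

Definition letter_val (a : Y * bool) : G := if a.2 then (t a.1)^-1%g else t a.1.

Definition free_lift (w : free_group Y) : G :=
  foldr (fun a g => letter_val a * g)%g 1%g (sval w).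

Lemma letter_valV a : letter_val (linv a) = (letter_val a)^-1%g.
Proof. by case: a => y [] //=; rewrite /letter_val /= invgK. Qed.

(** Reduction only removes a letter standing next to its inverse, and the values of these two cancel
    in [G]. *)
Fact free_liftM : {morph free_lift : u v / (u * v)%g}.
Proof.
move=> [u ru] [v rv]; rewrite /free_lift /=.
elim: u {ru} => [|a u IHu] /=; first by rewrite mul1g.
rewrite -mulgA -IHu; case: (fmulw u v) => [//|b w] /=.
by case: ifP => // /eqP->; rewrite letter_valV mulgA mulgV mul1g.
Qed.
HB.instance Definition _ := isMultiplicative.Build _ _ free_lift free_liftM.

Lemma free_lift_gen y : free_lift (free_gen y) = t y.
Proof. exact: mulg1. Qed.

End FreeGroupTheory.

(** The equaliser of two homomorphisms is a subgroup, so it is everything once it contains the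
    generators. *)
Lemma eq_hom_free (Y : choiceType) (G : groupType)
    (f f' : {multiplicative free_group Y -> G}) :
  (forall y, f (free_gen y) = f' (free_gen y)) -> f =1 f'.
Proof.
move=> eqf g; apply/eqP.
apply: (@free_group_ind _ [pred g | f g == f' g]) => [|y]; last exact/eqP.
split=> [|u v]; first by rewrite inE !mult1.
by rewrite !inE !gmulfM !multV => /eqP-> /eqP->.
Qed.

(** * Linear extension of maps from a group to its group algebra *)

Section Combination.
Variables (K : comPzRingType) (G : groupType).

Lemma grp_alg_supp (a : grp_alg K G) :
  exists2 s : seq G, uniq s & forall h, h \notin s -> sval a h = 0.
Proof.
have /asboolP/finite_seqP[s as_] := svalP a.
exists (undup s) => [|h]; first exact: undup_uniq.
rewrite mem_undup => /negP hs; apply/eqP; apply: contra_notT hs => ah.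
by have : [set` s] h by rewrite -as_.
Qed.

Definition delta_fun (h : G) : G -> K^o := fun g => (g == h)%:R.

Fact delta_fin_supp (h : G) : delta_fun h \in @fin_supp K G.
Proof.
apply/asboolP; apply: sub_finite_set (finite_set1 h) => g; rewrite /delta_fun /=.
by case: (eqVneq g h) => // _; rewrite mulr0n eqxx.
Qed.

Definition delta h : grp_alg K G := exist _ (delta_fun h) (delta_fin_supp h).

Lemma alg_trans_delta h g : alg_trans (delta h) g = delta (h * g)%g.
Proof.
apply: val_inj; apply/funext => k /=; rewrite /translate /delta_fun.
by rewrite -(inj_eq (@mulIg _ g)) mulgVK.
Qed.

Lemma grp_algE (a : grp_alg K G) (s : seq G) : uniq s ->
  (forall h, h \notin s -> sval a h = 0) ->
  a = \sum_(h <- s) (sval a h : K) *: delta h.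
Proof.
move=> us a0; apply: val_inj; apply/funext => g; rewrite linear_sum /= fct_sumE.
have [gs|gs] := boolP (g \in s).
  rewrite (bigD1_seq g) //= big1 ?addr0 => [|h hg].
    by rewrite -[RHS]/(sval a g * (g == g)%:R) eqxx mulr1.
  by rewrite -[LHS]/(sval a h * (g == h)%:R) eq_sym (negPf hg) mulr0.
rewrite big_seq big1 ?a0 // => h hs; rewrite -[LHS]/(sval a h * (g == h)%:R).
by case: eqP hs gs => [-> ->|_ _ _] //; rewrite mulr0.
Qed.

Variables (V : lmodType K) (w : G -> V).

(** The linear extension of [w] to KG. Summing over all of [G] with finite support avoids choosing a
    list that contains the support of [a]. *)
Definition comb (a : grp_alg K G) : V :=
  \sum_(h \in [set: G]) (sval a h : K) *: w h.

Lemma combE (a : grp_alg K G) (s : seq G) : uniq s ->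
  (forall h, h \notin s -> sval a h = 0) ->
  comb a = \sum_(h <- s) (sval a h : K) *: w h.
Proof.
move=> us a0; rewrite /comb (fsbigE s) //; last by move=> h _ /a0->; rewrite scale0r.
by apply: eq_bigl => h; rewrite in_setT.
Qed.

Lemma comb_linear : linear comb.
Proof.
move=> c a b; have [sa _ a0] := grp_alg_supp a; have [sb _ b0] := grp_alg_supp b.
(* One list containing both supports lets all three sums run over the same indices. *)
pose s := undup (sa ++ sb).
have us : uniq s by apply: undup_uniq.
have {}a0 h : h \notin s -> sval a h = 0.
  by rewrite mem_undup mem_cat negb_or => /andP[/a0].
have {}b0 h : h \notin s -> sval b h = 0.
  by rewrite mem_undup mem_cat negb_or => /andP[_ /b0].
have abE h : sval (c *: a + b) h = c * sval a h + sval b h by [].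
rewrite !(@combE _ s) // => [|h hs]; last by rewrite abE a0 // b0 // mulr0 addr0.
rewrite scaler_sumr -big_split; apply: eq_bigr => h _.
by rewrite abE scalerDl -scalerA.
Qed.
HB.instance Definition _ := GRing.isLinear.Build K (grp_alg K G) V _ comb comb_linear.

Lemma comb_delta h : comb (delta h) = w h.
Proof.
rewrite (@combE _ [:: h]) // => [|g]; last by rewrite inE /= /delta_fun => /negPf->.
by rewrite big_seq1 /= /delta_fun eqxx scale1r.
Qed.

End Combination.

Lemma act0 (K : comPzRingType) (A : rep K) (g : rgrp A) : 0 \o_ g = 0.
Proof.
apply: (addrI (0 \o_ g)).
by have := act_linear (@ract K A) g 1 0 0; rewrite !scale1r !addr0 => <-.
Qed.

(** * The universal property of W(X, Y) *)

Section FreeRepTheory.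
Variables (K : comPzRingType) (X Y : finType).

Definition basis (x : X) (h : free_group Y) : free_mod K X Y :=
  [ffun y => if y == x then delta K h else 0].

Lemma basis_act x h g : free_act_fun (basis x h) g = basis x (h * g)%g.
Proof.
apply/ffunP => y; rewrite !ffunE; case: ifP => _; first exact: alg_trans_delta.
by apply: val_inj.
Qed.

Lemma free_mod_ind (P : {pred free_mod K X Y}) :
  submod_closed P -> (forall x h, basis x h \in P) -> forall u, u \in P.
Proof.
move=> /[dup] Pmod [P0 PD] Pb u.
have PZ c v : v \in P -> c *: v \in P by move=> Pv; rewrite -[_ *: _]addr0 PD.
have Psum (I : Type) (s : seq I) F : (forall i, F i \in P) -> \sum_(i <- s) F i \in P.
  move=> PF; elim/big_ind: _ => // a b Pa Pb'.
  by rewrite -[a]scale1r PD.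
(* Split [u] into its coordinates first, then each coordinate over the group elements in its
   support. *)
rewrite (_ : u = \sum_x [ffun y => if y == x then u y else 0]).
  apply: (Psum) => x; have [s us ux] := grp_alg_supp (u x).
  rewrite (_ : finfun _ = \sum_(h <- s) (sval (u x) h : K) *: basis x h).
    by apply: (Psum) => h; apply: PZ.
  apply/ffunP => y; rewrite ffunE sum_ffunE.
  case: eqP => [->|nyx].
    rewrite [LHS](grp_algE us ux); apply: eq_bigr => h _.
    by rewrite !ffunE eqxx.
  by rewrite big1 // => h _; rewrite !ffunE; case: eqP => // _; rewrite scaler0.
apply/ffunP => y; rewrite sum_ffunE (bigD1 y) //= ffunE eqxx big1 ?addr0 // => x.
by rewrite ffunE eq_sym => /negPf->.
Qed.

Variables (A : rep K) (v : X -> rmod A) (t : Y -> rgrp A).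

Definition free_mod_lift (u : free_mod K X Y) : rmod A :=
  \sum_x comb (fun h => v x \o_ free_lift t h) (u x).

Lemma free_mod_lift_linear : linear free_mod_lift.
Proof.
move=> c a b; rewrite /free_mod_lift scaler_sumr -big_split.
by apply: eq_bigr => x _ /=; rewrite !ffunE linearP.
Qed.
HB.instance Definition _ :=
  GRing.isLinear.Build K (free_mod K X Y) (rmod A) _ free_mod_lift free_mod_lift_linear.

Lemma free_mod_lift_basis x h : free_mod_lift (basis x h) = v x \o_ free_lift t h.
Proof.
rewrite /free_mod_lift (bigD1 x) //= ffunE eqxx comb_delta big1 ?addr0 // => y.
by rewrite ffunE => /negPf->; rewrite linear0.
Qed.

(** Both sides are linear in [u], so it suffices to compare them on the elements [basis x h]. *)
Fact free_lift_act u g :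
  free_mod_lift (free_act_fun u g) = free_mod_lift u \o_ free_lift t g.
Proof.
apply/eqP; apply: (@free_mod_ind [pred u | free_mod_lift (free_act_fun u g) ==
                                           free_mod_lift u \o_ free_lift t g]).
  split=> [|c a b]; rewrite !inE; last first.
    move=> /eqP ea /eqP eb; rewrite free_act_linear !free_mod_lift_linear ea eb.
    by rewrite act_linear.
  rewrite linear0 act0.
  by rewrite [free_act_fun _ _](@act0 K (free_rep K X Y) g) linear0.
by move=> x h; rewrite inE basis_act !free_mod_lift_basis gmulfM actM.
Qed.

Definition free_rep_lift : rep_hom (free_rep K X Y) A :=
  @RepHom _ (free_rep K X Y) A free_mod_lift (free_lift t) free_lift_act.

End FreeRepTheory.

(** * Homomorphisms of representations: products, images, finite generation *)

Section Homomorphisms.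
Variable K : comPzRingType.
Implicit Types A B C : rep K.

Definition id_hom A : rep_hom A A :=
  @RepHom _ A A idfun idfun (fun _ _ => erefl).

Fact comp_hom_act A B C (g : rep_hom B C) (f : rep_hom A B) v h :
  (hom_mod g \o hom_mod f) (v \o_ h) =
  (hom_mod g \o hom_mod f) v \o_ (hom_grp g \o hom_grp f) h.
Proof. by rewrite /= !hom_act. Qed.

Definition comp_hom A B C (g : rep_hom B C) (f : rep_hom A B) : rep_hom A C :=
  RepHom (comp_hom_act g f).

Definition incl_hom A (S : subrep A) : rep_hom (rep_of_subrep S) A :=
  @RepHom _ (rep_of_subrep S) A \val \val (fun _ _ => erefl).

Section Product.
Variables (I : Type) (F : I -> rep K).

Definition proj_mod i (v : prod_mod F) : rmod (F i) := v i.
Definition proj_grp i (g : prod_grp F) : rgrp (F i) := g i.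

Fact proj_linear i : linear (@proj_mod i).
Proof. by []. Qed.
HB.instance Definition _ i :=
  GRing.isLinear.Build K (prod_mod F) (rmod (F i)) _ (@proj_mod i) (@proj_linear i).

Fact proj_mul i : {morph @proj_grp i : g h / (g * h)%g}.
Proof. by []. Qed.
HB.instance Definition _ i :=
  isMultiplicative.Build (prod_grp F) (rgrp (F i)) (@proj_grp i) (@proj_mul i).

Definition proj_hom i : rep_hom (rep_prod F) (F i) :=
  @RepHom _ (rep_prod F) (F i) (@proj_mod i) (@proj_grp i) (fun _ _ => erefl).

Variables (A : rep K) (f : forall i, rep_hom A (F i)).

Definition pair_mod (v : rmod A) : prod_mod F := fun i => hom_mod (f i) v.
Definition pair_grp (g : rgrp A) : prod_grp F := fun i => hom_grp (f i) g.

Fact pair_mod_linear : linear pair_mod.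
Proof. by move=> c u v; apply: functional_extensionality_dep => i; apply: linearP. Qed.
HB.instance Definition _ :=
  GRing.isLinear.Build K (rmod A) (prod_mod F) _ pair_mod pair_mod_linear.

Fact pair_grpM : {morph pair_grp : g h / (g * h)%g}.
Proof. by move=> g h; apply: functional_extensionality_dep => i; apply: gmulfM. Qed.
HB.instance Definition _ := isMultiplicative.Build (rgrp A) (prod_grp F) pair_grp pair_grpM.

Fact pair_act (v : rmod A) g : pair_mod (v \o_ g) = prod_act_fun (pair_mod v) (pair_grp g).
Proof. by apply: functional_extensionality_dep => i; apply: hom_act. Qed.

Definition pair_hom : rep_hom A (rep_prod F) :=
  @RepHom _ A (rep_prod F) pair_mod pair_grp pair_act.

End Product.

Section Image.
Variables (A B : rep K) (f : rep_hom A B).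

Definition img_mod : {pred rmod B} := [pred w | `[< exists v, hom_mod f v = w >]].
Definition img_grp : {pred rgrp B} := [pred h | `[< exists g, hom_grp f g = h >]].

Fact img_modP : submod_closed img_mod.
Proof.
split=> [|c _ _ /asboolP[u <-] /asboolP[v <-]]; apply/asboolP.
  by exists 0; apply: linear0.
by exists (c *: u + v); apply: linearP.
Qed.

Fact img_actP : act_closed img_mod img_grp.
Proof.
move=> _ _ /asboolP[u <-] /asboolP[g <-]; apply/asboolP.
by exists (u \o_ g); apply: hom_act.
Qed.

Definition img_subrep : subrep B := SubRep img_modP (image_group_closed (hom_grp f)) img_actP.

Definition corestr_mod (v : rmod A) : subrep_mod img_subrep :=
  exist _ (hom_mod f v) (asboolT (ex_intro _ v erefl)).
Definition corestr_grp (g : rgrp A) : subrep_grp img_subrep :=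
  exist _ (hom_grp f g) (asboolT (ex_intro _ g erefl)).

Fact corestr_linear : linear corestr_mod.
Proof. by move=> c u v; apply: val_inj; apply: linearP. Qed.
HB.instance Definition _ :=
  GRing.isLinear.Build K (rmod A) (subrep_mod img_subrep) _ corestr_mod corestr_linear.

Fact corestrM : {morph corestr_grp : g h / (g * h)%g}.
Proof. by move=> g h; apply: val_inj; apply: gmulfM. Qed.
HB.instance Definition _ :=
  isMultiplicative.Build (rgrp A) (subrep_grp img_subrep) corestr_grp corestrM.

Fact corestr_act (v : rmod A) g :
  corestr_mod (v \o_ g) = subrep_act_fun (corestr_mod v) (corestr_grp g).
Proof. by apply: val_inj; apply: hom_act. Qed.

Definition corestr_hom : rep_hom A (rep_of_subrep img_subrep) :=
  @RepHom _ A (rep_of_subrep img_subrep) corestr_mod corestr_grp corestr_act.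

Definition epi := (forall w, exists v, hom_mod f v = w) /\
                  (forall h, exists g, hom_grp f g = h).

Lemma epi_fg : epi -> fg_rep A -> fg_rep B.
Proof.
move=> [surm surg] [[sg Hg] [sm Hm]]; split.
  exists (map (hom_grp f) sg) => P Pgrp sP h; have [g <-] := surg h.
  have := Hg _ (preim_group_closed (hom_grp f) Pgrp); apply=> k ks.
  by rewrite inE sP ?map_f.
exists (map (hom_mod f) sm) => P [P0 PD] Pact sP w; have [v <-] := surm w.
apply: (Hm [pred u | hom_mod f u \in P]) => [|u g|u us].
- split=> [|c u u']; first by rewrite inE linear0.
  by rewrite !inE linearP; apply: PD.
- by rewrite !inE hom_act => Pu _; apply: Pact.
- by rewrite inE sP ?map_f.
Qed.

End Image.

Lemma corestr_epi A B (f : rep_hom A B) : epi (corestr_hom f).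
Proof.
split=> -[w wP]; have /asboolP[v vw] := wP; exists v; exact: val_inj.
Qed.

Lemma free_rep_fg X Y : fg_rep (free_rep K X Y).
Proof.
split.
  exists (map (@free_gen Y) (enum Y)) => P Pgrp sP.
  apply: free_group_ind => // y; apply: sP.
  by apply: map_f; rewrite mem_enum.
exists (map (fun x => @basis K X Y x 1%g) (enum X)) => P Pmod Pact sP.
apply: free_mod_ind => // x h; rewrite -[h]mul1g -basis_act.
by apply: Pact => //; apply: sP; apply: map_f; rewrite mem_enum.
Qed.

(** The free generators are the positions in the two generating lists, so repeated entries do no
    harm. *)
Lemma fg_rep_epi A : fg_rep A ->
  exists X Y : finType, exists f : rep_hom (free_rep K X Y) A, epi f.
Proof.
move=> [[sg Hg] [sm Hm]].
pose f := free_rep_lift (tnth (in_tuple sm)) (tnth (in_tuple sg)).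
exists 'I_(size sm), 'I_(size sg), f.
have surg h : exists g, hom_grp f g = h.
  apply/asboolP; apply: (Hg _ (image_group_closed (hom_grp f))) => {}h.
  move=> /(tnthP (in_tuple sg))[i ->]; apply/asboolP.
  by exists (free_gen i); apply: free_lift_gen.
split=> // w; apply/asboolP; apply: (Hm (img_mod f)) => [|v h Pv _|v].
- exact: img_modP.
(* The image is a priori stable only under the image group; by [surg] this is the whole group. *)
- by apply: img_actP => //; apply/asboolP; apply: surg.
- move=> /(tnthP (in_tuple sm))[i ->]; apply/asboolP; exists (basis K i 1%g).
  by rewrite [LHS]free_mod_lift_basis [free_lift _ _]mult1 act1.
Qed.

End Homomorphisms.

(** * The group of operators through which a group acts *)

Section ActionImage.
Variables (K : comPzRingType) (V : lmodType K) (G : groupType) (a : action V G).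

(** This is [G] modulo the kernel of the action. As elements are functions, equality means acting
    alike; products and inverses are computed on chosen representatives, and [op_act] shows that the
    choice is immaterial. *)
Definition op_grp := {p : V -> V | `[< exists g, a^~ g = p >]}.
HB.instance Definition _ := SubChoice.copy op_grp {p : V -> V | `[< exists g, a^~ g = p >]}.

Definition op_of (g : G) : op_grp := exist _ (a^~ g) (asboolT (ex_intro _ g erefl)).

Lemma op_ofP (p : op_grp) : exists g, op_of g = p.
Proof. by case: p => p pP; have /asboolP[g gp] := pP; exists g; apply: val_inj. Qed.

Definition op_rep (p : op_grp) : G := sval (cid (op_ofP p)).

Lemma op_repK : cancel op_rep op_of.
Proof. by move=> p; rewrite /op_rep; case: cid. Qed.

Definition op_mul (p q : op_grp) := op_of (op_rep p * op_rep q)%g.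
Definition op_inv (p : op_grp) := op_of (op_rep p)^-1%g.

Lemma eq_op g h : (forall v, a v g = a v h) -> op_of g = op_of h.
Proof. by move=> gh; apply/val_inj/funext. Qed.

Lemma op_act g v : a v (op_rep (op_of g)) = a v g.
Proof. exact: (congr1 (fun p : op_grp => sval p v) (op_repK (op_of g))). Qed.

Fact op_ofM : {morph op_of : g h / (g * h)%g >-> op_mul g h}.
Proof. by move=> g h; apply: eq_op => v; rewrite !actM !op_act. Qed.

Fact op_mulA : associative op_mul.
Proof.
move=> p q r; rewrite -[p]op_repK -[q]op_repK -[r]op_repK.
by rewrite -!op_ofM mulgA.
Qed.
Fact op_mul1 : left_id (op_of 1) op_mul.
Proof. by move=> p; rewrite -[p]op_repK -op_ofM mul1g. Qed.
Fact op_mulr1 : right_id (op_of 1) op_mul.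
Proof. by move=> p; rewrite -[p]op_repK -op_ofM mulg1. Qed.
Fact op_mulV : left_inverse (op_of 1) op_inv op_mul.
Proof. by move=> p; rewrite -[in X in op_mul _ X](op_repK p) -op_ofM mulVg. Qed.
Fact op_mulrV : right_inverse (op_of 1) op_inv op_mul.
Proof. by move=> p; rewrite -[in X in op_mul X _](op_repK p) -op_ofM mulgV. Qed.
HB.instance Definition _ := isGroup.Build op_grp op_mulA op_mul1 op_mulr1 op_mulV op_mulrV.
HB.instance Definition _ := isMultiplicative.Build G op_grp op_of op_ofM.

Definition op_act_fun (v : V) (p : op_grp) : V := a v (op_rep p).

Fact op_act_linear p : linear (op_act_fun^~ p).
Proof. exact: act_linear. Qed.
Fact op_act1 v : op_act_fun v 1%g = v.
Proof. by rewrite /op_act_fun op_act act1. Qed.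
Fact op_actM v p q : op_act_fun v (p * q)%g = op_act_fun (op_act_fun v p) q.
Proof. by rewrite /op_act_fun op_act actM. Qed.

Definition op_action : action V op_grp := Action op_act_linear op_act1 op_actM.

End ActionImage.

(** Both groups map onto the faithful group [op_grp a]: the map from [H] gives the Q^r step, the map
    from [G] the Q^0 step. *)
Lemma same_operators (K : comPzRingType) (X : rep_class K) (V : lmodType K)
    (G H : groupType) (a : action V G) (b : action V H) :
  X (Rep b) ->
  (forall g, exists h, forall v, a v g = b v h) ->
  (forall h, exists g, forall v, a v g = b v h) ->
  op_Q0 (op_Qr X) (Rep a).
Proof.
move=> Xb ab ba.
pose f : rep_hom (Rep a) (Rep (op_action a)) :=
  @RepHom _ (Rep a) (Rep (op_action a)) idfun (op_of a) (fun v g => esym (op_act a g v)).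
exists (op_grp a), (op_action a), f; split => //; last exact: op_ofP.
pose t h := op_of a (sval (cid (ba h))).
have tE h v : op_act_fun v (t h) = b v h.
  by rewrite /op_act_fun /t op_act; case: cid.
(* Faithfulness makes [t] multiplicative, although it is defined through choices. *)
have opI p q : (forall v, op_act_fun v p = op_act_fun v q) -> p = q.
  by move=> pq; rewrite -[p]op_repK -[q]op_repK; apply: eq_op.
have tM : {morph t : h k / (h * k)%g}.
  by move=> h k; apply: opI => v; rewrite op_actM !tE actM.
pose tm := HB.pack_for {multiplicative H -> op_grp a} t
  (isMultiplicative.Build H (op_grp a) t tM).
exists H, b, (@RepHom _ (Rep b) (Rep (op_action a)) idfun tm (fun v h => esym (tE h v))).
split=> // p; have [g <-] := op_ofP p; have [h gh] := ab g.
by exists h; apply: opI => v; rewrite [LHS]tE /op_act_fun op_act gh.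
Qed.

(** * Closed kernels and their stability under the operators *)

Section ClosedKernels.
Variable K : comPzRingType.
Variable R : rep K.

(** One inclusion expresses equality, the other being [sub_nabla2]. *)
Definition closed_ker X Y A (f : rep_hom (free_rep K X Y) A) : Prop :=
  nabla2 R (hom_ker f) `<=` hom_ker f.

Definition closed_kernels A : Prop :=
  forall X Y (f : rep_hom (free_rep K X Y) A), closed_ker f.

(** Composing with [i] leaves kernels unchanged. Only the module part has to be injective, so this
    covers subrepresentations, isomorphisms and Q^0 at once. *)
Lemma closed_kernels_inj A B (i : rep_hom A B) :
  injective (hom_mod i) -> closed_kernels B -> closed_kernels A.
Proof.
move=> injf clB X Y f.
suff kerE : hom_ker (comp_hom i f) = hom_ker f.
  by have := clB _ _ (comp_hom i f); rewrite /closed_ker kerE.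
apply/seteqP; split=> v; rewrite /hom_ker /=; last by move=> ->; apply: linear0.
by move=> fv0; apply: injf; rewrite fv0 linear0.
Qed.

(** The kernel of [f] is contained in the kernel of each component, so its double nabla is contained
    in that of each component kernel. *)
Lemma closed_kernels_prod I (F : I -> rep K) :
  (forall i, closed_kernels (F i)) -> closed_kernels (rep_prod F).
Proof.
move=> clF X Y f v nv; apply: functional_extensionality_dep => i.
apply: (clF i X Y (comp_hom (proj_hom F i) f)) => g kg; apply: nv => u fu.
by apply: kg; rewrite /hom_ker /= fu.
Qed.

Lemma closed_kernels_self : closed_kernels R.
Proof. by move=> X Y f v; apply. Qed.

Lemma closed_kernels_Qr (D : groupType) A (a : action (rmod A) D) (q : rep_hom (Rep a) A) :
  hom_mod q =1 id -> (forall g, exists d, hom_grp q d = g) ->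
  closed_kernels (Rep a) -> closed_kernels A.
Proof.
move=> qid surq cla X Y f.
(* Lift the images of the generators to [D]. The module map, hence the kernel, stays the same. *)
pose t y := sval (cid (surq (hom_grp f (free_gen y)))).
have tE : hom_grp q \o free_lift t =1 hom_grp f.
  by apply: eq_hom_free => y /=; rewrite free_lift_gen /t; case: cid.
have fact v g : hom_mod f (free_act_fun v g) = a (hom_mod f v) (free_lift t g).
  rewrite [LHS]hom_act -tE.
  by rewrite -[in LHS](qid (hom_mod f v)) -[LHS](hom_act q) qid.
exact: (cla X Y (@RepHom _ (free_rep K X Y) (Rep a) (hom_mod f) (free_lift t) fact)).
Qed.

Lemma closed_kernels_op A :
  op_Q0 (op_Qr (op_S (op_C (op_single R)))) A -> closed_kernels A.
Proof.
move=> [D [a [f [[E [b [q [qX qid surq]]] fid _]]]]].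
apply: (closed_kernels_inj (i := f)) => [u v|]; first by rewrite !fid.
apply: closed_kernels_Qr qid surq _.
have iso_closed B C : rep_iso B C -> closed_kernels C -> closed_kernels B.
  by move=> [i [/bij_inj inji _]]; apply: closed_kernels_inj inji.
have [B [S [[I [F [FR BF]]] iS]]] := qX.
apply: (iso_closed _ _ iS).
apply: (closed_kernels_inj (i := incl_hom S)); first exact: val_inj.
apply: (iso_closed _ _ BF); apply: closed_kernels_prod => i.
exact: iso_closed (FR i) closed_kernels_self.
Qed.

Lemma rep_iso_refl (A : rep K) : rep_iso A A.
Proof. by exists (id_hom A); split; exists id. Qed.

(** One factor for each homomorphism killing [T], so that the kernel of the diagonal map [nabla_hom]
    is the intersection defining [nabla2 R T]. *)
Definition nabla_prod X Y (T : set (free_mod K X Y)) : rep K :=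
  rep_prod (fun _ : {f | nabla R T f} => R).

Definition nabla_hom X Y (T : set (free_mod K X Y)) :
    rep_hom (free_rep K X Y) (nabla_prod T) :=
  pair_hom (fun f : {f | nabla R T f} => sval f).

Lemma nabla_hom_ker X Y (T : set (free_mod K X Y)) :
  hom_ker (nabla_hom T) = nabla2 R T.
Proof.
apply/seteqP; split=> v.
  move=> v0 f Tf; exact: (congr1 (fun w : rmod (nabla_prod T) => w (exist _ f Tf)) v0).
by move=> nv; apply: functional_extensionality_dep => -[f Tf]; apply: nv.
Qed.

Lemma nabla_prod_op_C X Y (T : set (free_mod K X Y)) : op_C (op_single R) (nabla_prod T).
Proof.
exists _, (fun _ : {f | nabla R T f} => R); split=> [_|]; exact: rep_iso_refl.
Qed.

Lemma sub_nabla2 X Y (T : set (free_mod K X Y)) : T `<=` nabla2 R T.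
Proof. by move=> v Tv f; apply. Qed.

(* [W] and the image [S] of the free representation in the product have isomorphic
   modules; once transported along this isomorphism, the group of [S] acts on the
   module of [W] through the same operators as the group of [W] does. *)
Lemma op_closed_ker X Y W (f : rep_hom (free_rep K X Y) W) :
  epi f -> closed_ker f -> op_Q0 (op_Qr (op_S (op_C (op_single R)))) W.
Proof.
case: W f => V G a f [surm surg] clf.
pose phi := nabla_hom (hom_ker f); pose S := img_subrep phi; pose c := corestr_hom phi.
(* Closedness enters here: [c] and [f] have the same kernel on the free module. *)
have kerE v : (hom_mod c v == 0) = (hom_mod f v == 0).
  apply/eqP/eqP => [cv0|fv0].
    by apply: clf; rewrite -nabla_hom_ker; apply: (congr1 val cv0).
  apply: val_inj; have : hom_ker phi v by rewrite nabla_hom_ker; apply: sub_nabla2.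
  by [].
have eqE u v : (hom_mod c u == hom_mod c v) = (hom_mod f u == hom_mod f v).
  by rewrite -subr_eq0 -[RHS]subr_eq0 -!linearB kerE.
have [csurm csurg] := corestr_epi phi.
(* Chosen sections of [f] and [c] yield mutually inverse maps [theta] and [eta] between [V] and the
   module of [S]; equality of kernels makes them independent of the sections. *)
pose sm w := sval (cid (surm w)); have smK w : hom_mod f (sm w) = w by rewrite /sm; case: cid.
pose theta w := hom_mod c (sm w).
have thetaE u : theta (hom_mod f u) = hom_mod c u by apply/eqP; rewrite eqE smK.
pose sc s := sval (cid (csurm s)); have scK s : hom_mod c (sc s) = s by rewrite /sc; case: cid.
pose eta s := hom_mod f (sc s).
have etaE u : eta (hom_mod c u) = hom_mod f u by apply/eqP; rewrite -eqE scK.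
pose H := rgrp (rep_of_subrep S).
pose b_fun (v : V) (h : H) : V := eta (@ract _ (rep_of_subrep S) (theta v) h).
have bE u g : b_fun (hom_mod f u) (hom_grp c g) = hom_mod f (free_act_fun u g).
  by rewrite /b_fun thetaE -(hom_act c) etaE.
have b_linear h : linear (b_fun^~ h).
  have [g <-] := csurg h; move=> k u v; rewrite -[u]smK -[v]smK -linearP !bE.
  by rewrite free_act_linear linearP.
have b1 v : b_fun v 1%g = v.
  by rewrite -[v]smK -(mult1 (hom_grp c)) bE free_act1.
have bM v g h : b_fun v (g * h)%g = b_fun (b_fun v g) h.
  have [g' <-] := csurg g; have [h' <-] := csurg h.
  by rewrite -[v]smK -gmulfM bE (bE _ g') bE free_actM.
apply: (same_operators (b := Action b_linear b1 bM)); last first.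
- move=> h; have [g <-] := csurg h; exists (hom_grp f g) => v.
  by rewrite /= -[v]smK bE (hom_act f).
- move=> h; have [g <-] := surg h; exists (hom_grp c g) => v.
  by rewrite /= -[v]smK bE (hom_act f).
(* It remains to see that [V] with the transported action of [H] is isomorphic to [S], by [theta]
   and the identity of [H]. *)
exists (nabla_prod (hom_ker f)), S; split; first exact: nabla_prod_op_C.
have theta_linear : linear theta.
  by move=> k u v; rewrite -[u]smK -[v]smK -linearP !thetaE linearP.
pose th := HB.pack_for {linear V -> subrep_mod S} theta
  (GRing.isLinear.Build K V (subrep_mod S) _ theta theta_linear).
have thact v (h : H) : theta (b_fun v h) = subrep_act_fun (theta v) h.
  have [g <-] := csurg h; rewrite -[v]smK bE !thetaE; exact: (hom_act c).
exists (@RepHom _ (Rep (Action b_linear b1 bM)) (rep_of_subrep S) th idfun thact).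
split; last by exists id.
exists eta => [v|s] /=; first by rewrite -[v]smK thetaE etaE.
by rewrite -[s]scK etaE thetaE.
Qed.

Lemma op_sub W (S : subrep W) :
  fg_rep (rep_of_subrep S) -> closed_kernels W ->
  op_Q0 (op_Qr (op_S (op_C (op_single R)))) (rep_of_subrep S).
Proof.
move=> /fg_rep_epi[X [Y [f fepi]]] clW; apply: (op_closed_ker fepi).
exact: (closed_kernels_inj (i := incl_hom S) val_inj clW).
Qed.

End ClosedKernels.

(** * Comparing two representations *)

Lemma nabla2_sub_of_op_L (K : comPzRingType) (R1 R2 : rep K) :
  (forall W, op_L (op_Q0 (op_Qr (op_S (op_C (op_single R1))))) W ->
             op_L (op_Q0 (op_Qr (op_S (op_C (op_single R2))))) W) ->
  forall (X Y : finType) (T : set (free_mod K X Y)), nabla2 R2 T `<=` nabla2 R1 T.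
Proof.
move=> L12 X Y T; pose c := corestr_hom (nabla_hom R1 T).
have kerc : hom_ker c = nabla2 R1 T.
  rewrite -nabla_hom_ker; apply/seteqP; split=> v; last by move=> v0; apply: val_inj.
  exact: (congr1 val).
(* The assumption concerns L-classes, so it is applied to the whole product and then to its finitely
   generated image subrepresentation. *)
have LQ : op_L (op_Q0 (op_Qr (op_S (op_C (op_single R1))))) (nabla_prod R1 T).
  move=> S Sfg; apply: op_sub => //; apply: closed_kernels_prod => _.
  exact: closed_kernels_self.
have Sfg := epi_fg (corestr_epi (nabla_hom R1 T)) (free_rep_fg K X Y).
have clc : closed_kernels R2 _ := closed_kernels_op (L12 _ LQ _ Sfg).
have := clc X Y c; rewrite /closed_ker kerc => clN v nv.
(* Monotonicity: a map killing [nabla2 R1 T] also kills [T]. *)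
apply: clN => f Nf; apply: nv => u Tu; apply: Nf; exact: sub_nabla2.
Qed.

Lemma op_L_of_nabla2 (K : comPzRingType) (R1 R2 : rep K) :
  action_geom_equiv R1 R2 ->
  forall W, op_L (op_Q0 (op_Qr (op_S (op_C (op_single R1))))) W ->
            op_L (op_Q0 (op_Qr (op_S (op_C (op_single R2))))) W.
Proof.
move=> R12 W LW S Sfg; have [X [Y [f fepi]]] := fg_rep_epi Sfg.
(* Being R2-closed now becomes being R1-closed, which holds since [S] lies in the class of [R1]. *)
apply: (op_closed_ker fepi); rewrite /closed_ker -R12.
have clS : closed_kernels R1 _ := closed_kernels_op (LW S Sfg).
exact: clS.
Qed.

Theorem corollary2 (K : comPzRingType) (R1 R2 : rep K) :
  action_geom_equiv R1 R2 <->
  same_class (op_L (op_Q0 (op_Qr (op_S (op_C (op_single R1))))))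
             (op_L (op_Q0 (op_Qr (op_S (op_C (op_single R2)))))).
Proof.
split=> [R12 W|L12 X Y T].
  have R21 : action_geom_equiv R2 R1 by move=> X Y T; rewrite R12.
  by split; apply: op_L_of_nabla2.
by apply/seteqP; split; apply: nabla2_sub_of_op_L => W /L12.
Qed.
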